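(* Let $G=(V,E)$ be a graph with $|V|=n$, and let $k,\ell$ be integers with $1\le k\le n$ and $\ell\ge 1$. Then $G\in\mathfrak{Gr}(n,k,\ell)$ if and only if $$n-\min\{|N[X]\,\triangle\,N[Y]| : X,Y\subseteq V,\ X\ne Y,\ |X|\le\ell,\ |Y|\le\ell\}\le k-1.$$
   Context: All graphs are finite, simple and undirected. For a graph $G=(V,E)$ and $x\in V$, $N[x]=\{x\}\cup\{y: xy\in E\}$; for $X\subseteq V$, $N[X]=\bigcup_{x\in X}N[x]$ (so $N[\emptyset]=\emptyset$). $A\triangle B=(A\setminus B)\cup(B\setminus A)$. A set $C\subseteq V$ is $(1,\le\ell)$-identifying if $N[X]\cap C\neq N[Y]\cap C$ for all distinct $X,Y\subseteq V$ with $|X|\le\ell$, $|Y|\le\ell$. For $n\ge k\ge1$ and $\ell\ge1$, $\mathfrak{Gr}(n,k,\ell)$ is the set of graphs on $n$ vertices in which every $k$-element subset of vertices is $(1,\le\ell)$-identifying. *)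

(* Defs.v *)
From mathcomp Require Import all_boot all_order all_algebra.

Set Implicit Arguments.
Unset Strict Implicit.
Unset Printing Implicit Defensive.

Record sgraph := SGraph {
  vertex :> finType;
  adj : rel vertex;
  adj_sym : symmetric adj;
  adj_irrefl : irreflexive adj
}.

Section Identifying.
Variable G : sgraph.
Implicit Types (x : G) (X Y C A B : {set G}).

Definition closed_nbhd x : {set G} := [set y | (y == x) || adj x y].

Definition closed_nbhds X : {set G} := \bigcup_(x in X) closed_nbhd x.

Definition symdiff A B : {set G} := (A :\: B) :|: (B :\: A).

Definition identifying (l : nat) C : Prop :=
  forall X Y, X <> Y -> #|X| <= l -> #|Y| <= l ->
    closed_nbhds X :&: C <> closed_nbhds Y :&: C.

Definition admissible (l : nat) (p : {set G} * {set G}) : bool :=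
  [&& p.1 != p.2, #|p.1| <= l & #|p.2| <= l].

(* The index #|G| of the iterated minimum bounds every term, so it plays no
   role as soon as an admissible pair exists; see [min_symdiffP]. *)
Definition min_symdiff (l : nat) : nat :=
  \big[minn/#|G|]_(p : {set G} * {set G} | admissible l p)
    #|symdiff (closed_nbhds p.1) (closed_nbhds p.2)|.

Lemma min_symdiffP (l : nat) : 0 < #|G| -> 0 < l ->
  (exists2 p, admissible l p &
     min_symdiff l = #|symdiff (closed_nbhds p.1) (closed_nbhds p.2)|) /\
  (forall p, admissible l p ->
     min_symdiff l <= #|symdiff (closed_nbhds p.1) (closed_nbhds p.2)|).
Proof.
move=> /card_gt0P [v _] l_gt0.
set F := fun p : {set G} * {set G} =>
  #|symdiff (closed_nbhds p.1) (closed_nbhds p.2)|.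
have le_min p : admissible l p -> min_symdiff l <= F p.
  by move=> Pp; rewrite /min_symdiff -minEnat -leEnat; exact: (Order.TotalTheory.bigmin_le_cond _ F Pp).
split=> //.
have adm0 : admissible l (set0, [set v]).
  rewrite /admissible /= cards0 cards1 l_gt0 andbT /=.
  by rewrite eq_sym -card_gt0 cards1.
have [[p Pp ->]|min_top] :
    (exists2 p, admissible l p & min_symdiff l = F p) \/ min_symdiff l = #|G|.
- rewrite /min_symdiff; elim/big_ind: _ => [|a b IHa IHb|p Pp].
  + by right.
  + by rewrite /minn; case: ifP.
  + by left; exists p.
- by exists p.
- exists (set0, [set v]) => //; apply/eqP; rewrite eqn_leq le_min //= min_top.
  exact: max_card.
Qed.

End Identifying.

Definition Gr (n k l : nat) (G : sgraph) : Prop :=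
  #|G| = n /\ forall C : {set G}, #|C| = k -> identifying l C.

(* Main.v *)
Require Import Defs.
From mathcomp Require Import all_boot all_order all_algebra.
From mathcomp Require Import zify.

(* A set C fails to separate X from Y exactly when C avoids the symmetric
   difference D of N[X] and N[Y].  A k-set avoiding D exists if and only if
   |D| <= n - k, and the smallest D is the easiest one to avoid. *)

Lemma setI_eq_symdiff (G : sgraph) (A B C : {set G}) :
  (A :&: C == B :&: C) = (C \subset ~: symdiff A B).
Proof.
apply/eqP/subsetP => [eqAB x Cx | sCD].
  by have /setP/(_ x) := eqAB; rewrite !inE Cx !andbT => ->; case: (x \in B).
apply/setP => x; rewrite !inE; case Cx: (x \in C); rewrite ?andbF ?andbT //.
by have := sCD x Cx; rewrite !inE; case: (x \in A); case: (x \in B).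
Qed.

(** The [k]-subsets of [A] are counted by a binomial coefficient, which is positive as
    [k <= #|A|]. *)
Lemma subset_of_card (T : finType) (A : {set T}) (k : nat) :
  k <= #|A| -> exists2 B : {set T}, B \subset A & #|B| = k.
Proof.
rewrite -bin_gt0 -cards_draws => /card_gt0P [B].
by rewrite inE => /andP [sBA /eqP cardB]; exists B.
Qed.

Theorem theorem7 (G : sgraph) (n k l : nat)
    (card_G : #|G| = n) (k_ge1 : 1 <= k) (k_le_n : k <= n) (l_ge1 : 1 <= l) :
  Gr n k l G <->
  (n%:Z - (min_symdiff G l)%:Z <= k%:Z - 1)%R.
Proof.
have G_gt0 : 0 < #|G| by rewrite card_G (leq_trans k_ge1).
have [[[X Y] /and3P [/= /eqP neqXY leX leY] minE] min_le] := @min_symdiffP G l G_gt0 l_ge1.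
have -> : (n%:Z - (min_symdiff G l)%:Z <= k%:Z - 1)%R = (n < k + min_symdiff G l).
  by lia.
split=> [[_ idG] | lt_n].
  (* Otherwise the complement of D for the minimizing pair [X], [Y] has at least [k] elements, and
     any [k]-set [C] inside it is not identifying. *)
  rewrite ltnNge; apply/negP => le_n.
  have [|C sCD cardC] := @subset_of_card G
      (~: symdiff (closed_nbhds X) (closed_nbhds Y)) k.
    rewrite -(leq_add2l #|symdiff (closed_nbhds X) (closed_nbhds Y)|) cardsC card_G.
    by rewrite addnC -minE.
  apply: (idG C cardC X Y neqXY leX leY).
  by apply/eqP; rewrite setI_eq_symdiff.
split=> // C cardC X' Y' /eqP neqXY' leX' leY' /eqP.
(* If [C] avoids D for [X'], [Y'], then [|D| + k <= n]; as [|D|] is at least the minimum, this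
   contradicts [lt_n]. *)
rewrite setI_eq_symdiff => /subset_leq_card.
have /min_le /= : admissible l (X', Y') by apply/and3P.
rewrite cardC -(leq_add2l #|symdiff (closed_nbhds X') (closed_nbhds Y')| k) cardsC card_G.
by lia.
Qed.
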